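(* Let $(A, \mu_1, \dots, \mu_n, \varepsilon, \alpha)$ be a Rota-Baxter Hom-$X$ color algebra and let $\beta : A\to A$ be an endomorphism of $A$. Then, for any nonnegative integer $m$, $$A_\beta=(A,\ \mu_\beta^1=\beta^m\circ\mu_1,\ \dots,\ \mu_\beta^n=\beta^m\circ\mu_n,\ \varepsilon,\ \beta^m\circ\alpha)$$ is a Rota-Baxter Hom-$X$ color algebra, where $\beta^m=\beta\circ\beta^{m-1}$ (and $\beta^0=\mathrm{id}$). Moreover, suppose that $(A', \mu'_1, \dots, \mu'_n, \varepsilon, \alpha')$ is another Hom-$X$ color algebra and $\beta' : A'\to A'$ is an algebra endomorphism, and let $A'_{\beta'}=(A',\beta'^m\circ\mu'_1,\dots,\beta'^m\circ\mu'_n,\varepsilon,\beta'^m\circ\alpha')$. If $f : A\to A'$ is a morphism of Hom-$X$ color algebras that satisfies $f\circ\beta=\beta'\circ f$, then $f : A_{\beta}\to A'_{\beta'}$ is also a morphism of Hom-$X$ color algebras.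
   Context: All vector spaces are over a field $\mathbb{K}$ of characteristic different from $2$, $G$ is an abelian group, and a linear map or bilinear map between $G$-graded spaces is called even if it preserves degree. $\mathcal{H}(A)$ denotes the set of homogeneous elements of a $G$-graded space $A$. A bicharacter on $G$ is a map $\varepsilon:G\times G\to\mathbb{K}^*$ with $\varepsilon(a,b)\varepsilon(b,a)=1$, $\varepsilon(a,b+c)=\varepsilon(a,b)\varepsilon(a,c)$, $\varepsilon(a+b,c)=\varepsilon(a,c)\varepsilon(b,c)$ for all $a,b,c\in G$. For homogeneous $x,y$ of degrees $a,b$ one writes $\varepsilon(x,y):=\varepsilon(a,b)$. A color Hom-algebra is a tuple $(A,\mu_1,\dots,\mu_n,\varepsilon,\alpha)$ where $A$ is a $G$-graded linear space, $\mu_i:A\otimes A\to A$ are even bilinear maps, $\varepsilon$ is a bicharacter on $G$ and $\alpha:A\to A$ is an even linear map (the twisting map). A Hom-$X$ color algebra is a color Hom-algebra for which the axioms defining the structure of $X$ are linear combinations of terms of the form either $\mu_j\circ(\mu_i\otimes\alpha)$ or $\mu_j\circ(\alpha\otimes\mu_i)$. Examples: Hom-associative color algebras, with axiom $\mu(\mu(x,y),\alpha(z))-\mu(\alpha(x),\mu(y,z))=0$; Hom-Leibniz color algebras, with axiom $\mu(\alpha(x),\mu(y,z))+\varepsilon(y,z)\mu(\mu(x,z),\alpha(y))-\mu(\mu(x,y),\alpha(z))=0$. A morphism of color Hom-algebras (in particular of Hom-$X$ color algebras) $f:(A,\mu_1,\dots,\mu_n,\varepsilon,\alpha)\to(A',\mu'_1,\dots,\mu'_n,\varepsilon,\alpha')$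 is an even linear map with $f\circ\alpha=\alpha'\circ f$ and $f(\mu_i(x,y))=\mu'_i(f(x),f(y))$ for all $x,y\in\mathcal{H}(A)$ and all $i=1,\dots,n$; an endomorphism is a morphism from an algebra to itself. A color Hom-algebra is called a Rota-Baxter color Hom-algebra if it is endowed with an even linear map $R:A\to A$ (a Rota-Baxter operator on $A$) such that, with $\lambda\in\mathbb{K}$, $\mu_i(R(x),R(y))=R\big(\mu_i(R(x),y)+\mu_i(x,R(y))+\lambda\mu_i(x,y)\big)$ for all $i=1,\dots,n$ and $x,y\in\mathcal{H}(A)$. A Rota-Baxter Hom-$X$ color algebra is a Hom-$X$ color algebra endowed with such an operator.
   Formalization: For the original operator R to be Rota-Baxter on A_β, β is assumed to commute with R (the claim fails otherwise, e.g. K×K, R(x,y)=(x,0), λ=-1, β=swap, m=1); without this, only existence of some Rota-Baxter operator on A_β is asserted. *)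

(* Defs.v *)
From HB Require Import structures.
From mathcomp Require Export all_boot all_order all_algebra.

Set Implicit Arguments.
Unset Strict Implicit.
Unset Printing Implicit Defensive.

Import GRing.Theory.
Local Open Scope ring_scope.

(* The codomain K^* is encoded by nonvanishing. *)
Record is_bicharacter (K : fieldType) (G : zmodType) (eps : G -> G -> K)
    : Prop := IsBicharacter {
  bichar_neq0 : forall a b, eps a b != 0;
  bichar_sym : forall a b, eps a b * eps b a = 1;
  bicharDr : forall a b c, eps a (b + c) = eps a b * eps a c;
  bicharDl : forall a b c, eps (a + b) c = eps a c * eps b c }.

(* [gr a x] means that x lies in the component A_a.  The last two fields say
   that A is the direct sum of the A_a; the carrier may be infinite-dimensional
   and infinitely many components may be nonzero.  Note that 0 is homogeneous
   of every degree. *)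
Record is_grading (K : fieldType) (G : zmodType) (A : lmodType K)
    (gr : G -> A -> Prop) : Prop := IsGrading {
  grading0 : forall a, gr a 0;
  grading_lin : forall a (c : K) x y, gr a x -> gr a y -> gr a (c *: x + y);
  grading_span : forall x, exists (s : seq G) (f : G -> A),
    (forall a, gr a (f a)) /\ x = \sum_(a <- s) f a;
  grading_direct : forall (s : seq G) (f : G -> A), uniq s ->
    (forall a, gr a (f a)) -> \sum_(a <- s) f a = 0 ->
    forall a, a \in s -> f a = 0 }.

Definition homogeneous (G A : Type) (gr : G -> A -> Prop) (x : A) : Prop :=
  exists a, gr a x.

Record is_even_linear (K : fieldType) (G : zmodType) (A B : lmodType K)
    (grA : G -> A -> Prop) (grB : G -> B -> Prop) (f : A -> B)
    : Prop := IsEvenLinear {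
  even_linearP : GRing.linear_for *:%R f;
  even_linear_deg : forall a x, grA a x -> grB a (f x) }.

Record is_even_bilinear (K : fieldType) (G : zmodType) (A : lmodType K)
    (gr : G -> A -> Prop) (mu : A -> A -> A) : Prop := IsEvenBilinear {
  even_bilinearP : bilinear_for *:%R *:%R mu;
  even_bilinear_deg : forall a b x y, gr a x -> gr b y ->
    gr (a + b) (mu x y) }.

Record is_color_hom_algebra (K : fieldType) (G : zmodType) (A : lmodType K)
    (n : nat) (gr : G -> A -> Prop) (mu : 'I_n -> A -> A -> A)
    (eps : G -> G -> K) (alpha : A -> A) : Prop := IsColorHomAlgebra {
  cha_grading : is_grading gr;
  cha_mul : forall i, is_even_bilinear gr (mu i);
  cha_bichar : is_bicharacter eps;
  cha_twist : is_even_linear gr gr alpha }.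

(* An axiom scheme X is a set of formal axioms in three variables x_0, x_1, x_2
   ranging over homogeneous elements.
   [HomLeft j i p q r] stands for mu_j (mu_i (x_p, x_q), alpha (x_r)) and
   [HomRight j i p q r] for mu_j (alpha (x_p), mu_i (x_q, x_r)).  The variables
   may be permuted, as in the Leibniz identity, or repeated, as in the
   alternative laws. *)
Variant hom_monomial (n : nat) : Type :=
  | HomLeft (j i : 'I_n) (p q r : 'I_3)
  | HomRight (j i : 'I_n) (p q r : 'I_3).

(* A term is c * (\prod_((p, q) in sgn) eps (x_p, x_q)) * monomial; by the
   bicharacter laws such products also cover factors like eps (x, y + z) and
   inverses of values of eps. *)
Record hom_term (K : fieldType) (n : nat) : Type := HomTerm {
  ht_coef : K;
  ht_sgn : seq ('I_3 * 'I_3);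
  ht_mon : hom_monomial n }.

Definition hom_axiom (K : fieldType) (n : nat) : Type := seq (hom_term K n).

Section Evaluation.
Variables (K : fieldType) (G : zmodType) (A : lmodType K) (n : nat).
Variables (mu : 'I_n -> A -> A -> A) (eps : G -> G -> K) (alpha : A -> A).
(* d p is the degree of x p *)
Variables (d : 'I_3 -> G) (x : 'I_3 -> A).

Definition eval_monomial (t : hom_monomial n) : A :=
  match t with
  | HomLeft j i p q r => mu j (mu i (x p) (x q)) (alpha (x r))
  | HomRight j i p q r => mu j (alpha (x p)) (mu i (x q) (x r))
  end.

Definition eval_term (t : hom_term K n) : A :=
  (ht_coef t * \prod_(s <- ht_sgn t) eps (d s.1) (d s.2))
    *: eval_monomial (ht_mon t).

Definition eval_axiom (ax : hom_axiom K n) : A := \sum_(t <- ax) eval_term t.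

End Evaluation.

Definition is_homX (K : fieldType) (G : zmodType) (A : lmodType K) (n : nat)
    (X : hom_axiom K n -> Prop) (gr : G -> A -> Prop)
    (mu : 'I_n -> A -> A -> A) (eps : G -> G -> K) (alpha : A -> A) : Prop :=
  is_color_hom_algebra gr mu eps alpha /\
  forall ax, X ax -> forall (d : 'I_3 -> G) (x : 'I_3 -> A),
    (forall p, gr (d p) (x p)) -> eval_axiom mu eps alpha d x ax = 0.

Record is_morphism (K : fieldType) (G : zmodType) (A B : lmodType K) (n : nat)
    (grA : G -> A -> Prop) (muA : 'I_n -> A -> A -> A) (alphaA : A -> A)
    (grB : G -> B -> Prop) (muB : 'I_n -> B -> B -> B) (alphaB : B -> B)
    (f : A -> B) : Prop := IsMorphism {
  morphism_even : is_even_linear grA grB f;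
  morphism_twist : f \o alphaA =1 alphaB \o f;
  morphism_mul : forall i x y, homogeneous grA x -> homogeneous grA y ->
    f (muA i x y) = muB i (f x) (f y) }.

Definition is_endomorphism (K : fieldType) (G : zmodType) (A : lmodType K)
    (n : nat) (gr : G -> A -> Prop) (mu : 'I_n -> A -> A -> A)
    (alpha : A -> A) (beta : A -> A) : Prop :=
  is_morphism gr mu alpha gr mu alpha beta.

Record is_rota_baxter (K : fieldType) (G : zmodType) (A : lmodType K) (n : nat)
    (gr : G -> A -> Prop) (mu : 'I_n -> A -> A -> A) (lambda : K) (R : A -> A)
    : Prop := IsRotaBaxter {
  rb_even : is_even_linear gr gr R;
  rb_eq : forall i x y, homogeneous gr x -> homogeneous gr y ->
    mu i (R x) (R y) = R (mu i (R x) y + mu i x (R y) + lambda *: mu i x y) }.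

Definition is_rota_baxter_homX (K : fieldType) (G : zmodType) (A : lmodType K)
    (n : nat) (X : hom_axiom K n -> Prop) (gr : G -> A -> Prop)
    (mu : 'I_n -> A -> A -> A) (eps : G -> G -> K) (alpha : A -> A)
    (lambda : K) (R : A -> A) : Prop :=
  is_homX X gr mu eps alpha /\ is_rota_baxter gr mu lambda R.

Definition twist_mul (A : Type) (n : nat) (beta : A -> A) (m : nat)
    (mu : 'I_n -> A -> A -> A) : 'I_n -> A -> A -> A :=
  fun i x y => iter m beta (mu i x y).

Definition twist_map (A : Type) (beta : A -> A) (m : nat) (alpha : A -> A)
    : A -> A := iter m beta \o alpha.

(* Main.v *)
Require Import Defs.
From mathcomp Require Import all_boot all_order all_algebra.

Set Implicit Arguments.
Unset Strict Implicit.
Unset Printing Implicit Defensive.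

Import GRing.Theory.
Local Open Scope ring_scope.

(** Put b = beta^m, which is again an endomorphism ([is_endomorphism_iter]). Twisting a monomial of
    X puts one b in front of its outer product and one in front of each of its two arguments;
    multiplicativity merges the inner two into one, so the result is b^2 of the original monomial.
    This power does not depend on the monomial, so by linearity a twisted axiom evaluates to b^2 of
    the original one, that is b^2(0) = 0 ([eval_axiom_twist]). The Rota-Baxter identity for the
    twisted products is b applied to the original one, and b must then be moved past R: this is
    where [beta \o R =1 R \o beta] enters. Without it, an operator is supplied by the zero map
    ([is_rota_baxter0]). A morphism f intertwining beta and beta' also intertwines their powers,
    hence the twisted structures. *)

Lemma is_even_linear0 (K : fieldType) (G : zmodType) (A B : lmodType K)
    (grA : G -> A -> Prop) (grB : G -> B -> Prop) (f : A -> B) :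
  is_even_linear grA grB f -> f 0 = 0.
Proof.
by move=> [linf _]; have := linf (- 1) 0 0; rewrite /= scaler0 addr0 scaleN1r addNr.
Qed.

Lemma is_even_linearD (K : fieldType) (G : zmodType) (A B : lmodType K)
    (grA : G -> A -> Prop) (grB : G -> B -> Prop) (f : A -> B) (x y : A) :
  is_even_linear grA grB f -> f (x + y) = f x + f y.
Proof. by move=> [linf _]; have := linf 1 x y; rewrite !scale1r. Qed.

Lemma is_even_linearZ (K : fieldType) (G : zmodType) (A B : lmodType K)
    (grA : G -> A -> Prop) (grB : G -> B -> Prop) (f : A -> B) (c : K) (x : A) :
  is_even_linear grA grB f -> f (c *: x) = c *: f x.
Proof.
move=> hf; have := even_linearP hf c x 0.
by rewrite /= (is_even_linear0 hf) !addr0.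
Qed.

Lemma is_even_linear_comp (K : fieldType) (G : zmodType) (A B C : lmodType K)
    (grA : G -> A -> Prop) (grB : G -> B -> Prop) (grC : G -> C -> Prop)
    (f : A -> B) (g : B -> C) :
  is_even_linear grA grB f -> is_even_linear grB grC g ->
  is_even_linear grA grC (g \o f).
Proof.
move=> [linf degf] [ling degg]; split=> [c x y | a x /degf /degg //].
by rewrite /= linf ling.
Qed.

Lemma is_even_bilinear_comp (K : fieldType) (G : zmodType) (A : lmodType K)
    (gr : G -> A -> Prop) (mu : A -> A -> A) (b : A -> A) :
  is_even_linear gr gr b -> is_even_bilinear gr mu ->
  is_even_bilinear gr (fun x y => b (mu x y)).
Proof.
move=> [linb degb] [[mul mur] degmu]; split; last first.
  by move=> a c x y hx hy; apply/degb/degmu.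
by split=> u c x y /=; rewrite ?(mul u c x y) ?(mur u c x y) linb.
Qed.

Lemma is_endomorphism_iter (K : fieldType) (G : zmodType) (A : lmodType K)
    (n : nat) (gr : G -> A -> Prop) (mu : 'I_n -> A -> A -> A)
    (alpha beta : A -> A) (m : nat) :
  is_endomorphism gr mu alpha beta ->
  is_endomorphism gr mu alpha (iter m beta).
Proof.
move=> [evb twb mulb]; elim: m => [|m [evm twm mulm]]; first by split.
split.
- exact: is_even_linear_comp evm evb.
- by move=> x /=; rewrite [iter m beta _]twm; exact: twb.
(* [beta] is multiplicative on homogeneous elements, so its arguments [iter m beta x] and
   [iter m beta y] must be homogeneous: evenness gives this. *)
- move=> i x y hx hy; rewrite /= mulm // mulb //.
    by case: hx => a /(even_linear_deg evm); exists a.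
  by case: hy => a /(even_linear_deg evm); exists a.
Qed.

(* Every monomial uses two products or one product and one twist, so it picks
   up exactly b \o b whatever its shape: hence identities are preserved. *)
Lemma eval_monomial_twist (K : fieldType) (G : zmodType) (A : lmodType K)
    (n : nat) (gr : G -> A -> Prop) (mu : 'I_n -> A -> A -> A)
    (eps : G -> G -> K) (alpha b : A -> A)
    (d : 'I_3 -> G) (x : 'I_3 -> A) (t : hom_monomial n) :
  is_color_hom_algebra gr mu eps alpha ->
  is_endomorphism gr mu alpha b ->
  (forall p, gr (d p) (x p)) ->
  eval_monomial (fun i x y => b (mu i x y)) (b \o alpha) x t =
    b (b (eval_monomial mu alpha x t)).
Proof.
move=> [_ hmu _ [_ degal]] [_ _ mulb] hx.
have hal p : homogeneous gr (alpha (x p)) by exists (d p); apply: degal.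
have hm i p q : homogeneous gr (mu i (x p) (x q)).
  by exists (d p + d q); apply: (even_bilinear_deg (hmu i)).
(* [congr b] strips the outer twist; what remains is multiplicativity of [b] on the two arguments of
   the outer product. *)
by case: t => j i p q r /=; congr b; rewrite [RHS]mulb.
Qed.

(** The coefficients depend only on [eps] and the degrees [d], which twisting leaves alone, so the
    linear map b^2 factors out of the sum. *)
Lemma eval_axiom_twist (K : fieldType) (G : zmodType) (A : lmodType K)
    (n : nat) (gr : G -> A -> Prop) (mu : 'I_n -> A -> A -> A)
    (eps : G -> G -> K) (alpha b : A -> A)
    (d : 'I_3 -> G) (x : 'I_3 -> A) (ax : hom_axiom K n) :
  is_color_hom_algebra gr mu eps alpha ->
  is_endomorphism gr mu alpha b ->
  (forall p, gr (d p) (x p)) ->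
  eval_axiom (fun i x y => b (mu i x y)) eps (b \o alpha) d x ax =
    b (b (eval_axiom mu eps alpha d x ax)).
Proof.
move=> hA hb hx; have hl := morphism_even hb.
rewrite /eval_axiom; elim: ax => [|t ax IH].
  by rewrite !big_nil !(is_even_linear0 hl).
rewrite !big_cons IH !(is_even_linearD _ _ hl); congr (_ + _).
by rewrite /eval_term (eval_monomial_twist _ hA hb hx) !(is_even_linearZ _ _ hl).
Qed.

Lemma is_homX_twist (K : fieldType) (G : zmodType) (A : lmodType K)
    (n : nat) (X : hom_axiom K n -> Prop) (gr : G -> A -> Prop)
    (mu : 'I_n -> A -> A -> A) (eps : G -> G -> K) (alpha beta : A -> A)
    (m : nat) :
  is_homX X gr mu eps alpha -> is_endomorphism gr mu alpha beta ->
  is_homX X gr (twist_mul beta m mu) eps (twist_map beta m alpha).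
Proof.
move=> [hA hX] /(is_endomorphism_iter m) hb; have hl := morphism_even hb.
split.
  case: hA => hgr hmu heps hal; split=> //.
    by move=> i; apply: is_even_bilinear_comp.
  exact: is_even_linear_comp hal hl.
move=> ax hax d x hx.
by rewrite (eval_axiom_twist _ hA hb hx) hX // !(is_even_linear0 hl).
Qed.

Lemma is_rota_baxter_twist (K : fieldType) (G : zmodType) (A : lmodType K)
    (n : nat) (gr : G -> A -> Prop) (mu : 'I_n -> A -> A -> A)
    (lambda : K) (R beta : A -> A) (m : nat) :
  is_even_linear gr gr beta -> is_rota_baxter gr mu lambda R ->
  beta \o R =1 R \o beta ->
  is_rota_baxter gr (twist_mul beta m mu) lambda R.
Proof.
move=> hb [evR eqR] comm; split=> // i x y hx hy.
rewrite /twist_mul eqR //; elim: m => //= m ->.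
by rewrite [LHS]comm /= !(is_even_linearD _ _ hb) (is_even_linearZ _ _ hb).
Qed.

(** For the zero map both sides of the identity vanish, whatever the weight, because mu(0, 0) =
    0. *)
Lemma is_rota_baxter0 (K : fieldType) (G : zmodType) (A : lmodType K) (n : nat)
    (gr : G -> A -> Prop) (mu : 'I_n -> A -> A -> A) (eps : G -> G -> K)
    (alpha : A -> A) (lambda : K) :
  is_color_hom_algebra gr mu eps alpha ->
  is_rota_baxter gr mu lambda (fun=> 0).
Proof.
move=> [hgr hmu _ _]; split.
  split=> [c x y | a x _]; last exact: grading0 hgr a.
  by rewrite scaler0 addr0.
move=> i x y _ _; have [[_ mur] _] := hmu i.
by have := mur 0 (- 1) 0 0; rewrite /= scaler0 addr0 scaleN1r addNr.
Qed.

Lemma is_morphism_twist (K : fieldType) (G : zmodType) (A B : lmodType K)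
    (n : nat) (grA : G -> A -> Prop) (muA : 'I_n -> A -> A -> A)
    (alphaA betaA : A -> A) (grB : G -> B -> Prop)
    (muB : 'I_n -> B -> B -> B) (alphaB betaB : B -> B) (f : A -> B)
    (m : nat) :
  is_morphism grA muA alphaA grB muB alphaB f ->
  f \o betaA =1 betaB \o f ->
  is_morphism grA (twist_mul betaA m muA) (twist_map betaA m alphaA)
    grB (twist_mul betaB m muB) (twist_map betaB m alphaB) f.
Proof.
move=> [evf twf mulf] comm.
(* The intertwining relation passes to powers, so [f] carries the twist on the source to the twist
   on the target. *)
have commm x : f (iter m betaA x) = iter m betaB (f x).
  by elim: m => //= m <-; apply: comm.
split=> // [x | i x y hx hy].
  by rewrite /twist_map /= commm; congr iter; apply: twf.
by rewrite /twist_mul commm mulf.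
Qed.

Theorem theorem4p7 (K : fieldType) (charK : 2%N \notin [pchar K])
    (G : zmodType) (n : nat) (X : hom_axiom K n -> Prop)
    (eps : G -> G -> K)
    (A : lmodType K) (gr : G -> A -> Prop) (mu : 'I_n -> A -> A -> A)
    (alpha : A -> A) (lambda : K) (R : A -> A)
    (hA : is_rota_baxter_homX X gr mu eps alpha lambda R)
    (beta : A -> A) (hbeta : is_endomorphism gr mu alpha beta) (m : nat) :
  [/\ (* A_beta is a Rota-Baxter Hom-X color algebra *)
      exists R' : A -> A,
        is_rota_baxter_homX X gr (twist_mul beta m mu) eps
          (twist_map beta m alpha) lambda R',
      (* and, when beta preserves R, it is one for the operator R itself *)
      beta \o R =1 R \o beta ->
        is_rota_baxter_homX X gr (twist_mul beta m mu) eps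
          (twist_map beta m alpha) lambda R
    & forall (A' : lmodType K) (gr' : G -> A' -> Prop)
        (mu' : 'I_n -> A' -> A' -> A') (alpha' : A' -> A')
        (beta' : A' -> A') (f : A -> A'),
        is_homX X gr' mu' eps alpha' ->
        is_endomorphism gr' mu' alpha' beta' ->
        is_morphism gr mu alpha gr' mu' alpha' f ->
        f \o beta =1 beta' \o f ->
        is_homX X gr' (twist_mul beta' m mu') eps (twist_map beta' m alpha') /\
        is_morphism gr (twist_mul beta m mu) (twist_map beta m alpha)
          gr' (twist_mul beta' m mu') (twist_map beta' m alpha') f].
Proof.
have [hX hR] := hA.
have hXb := is_homX_twist m hX hbeta.
split.
- (* R itself need not commute with beta; the zero operator always works. *)
  by exists (fun=> 0); split=> //; apply: is_rota_baxter0 hXb.1.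
- move=> comm; split=> //.
  exact: is_rota_baxter_twist (morphism_even hbeta) hR comm.
- move=> A' gr' mu' alpha' beta' f hX' hbeta' hf comm.
  by split; [apply: is_homX_twist | apply: is_morphism_twist].
Qed.
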